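(* Suppose $f$ is $L_f$-smooth and $\mu_f$-strongly convex, $L_{\mathbf S}^{\max}<\infty$, and let $x^\star_{\mathcal D}$ be the minimizer of $\tilde f$. Let $0<\gamma\le 1/(L_fL_{\mathbf S}^{\max})$ and let $(x^t)$ be generated by the Double Sketched GD iteration. Then for every $T\ge 0$, $$\mathbb E\|x^T-x^\star_{\mathcal D}\|^2\le(1-\gamma\mu_{\mathcal D}\mu_f)^T\|x^0-x^\star_{\mathcal D}\|^2+\frac{2\gamma L_fL_{\mathbf S}^{\max}}{\mu_f\mu_{\mathcal D}}\big(\tilde f^{\inf}-f^{\inf}\big).$$
   Context: Let $f:\mathbb R^d\to\mathbb R$, fix $s\in\mathbb R^d$, and let $\mathcal D$ be a distribution of random matrices $\mathbf S\in\mathbb R^{d\times d}$ with $\mathbb E[\mathbf S]=I$ and $\mathbb E[\mathbf S^\top\mathbf S]$ finite. Define $f_{\mathbf S}(x)=f(s+\mathbf S(x-s))$, $\tilde f(x)=\mathbb E_{\mathbf S\sim\mathcal D}[f_{\mathbf S}(x)]$, $\tilde f^{\inf}=\inf_x\tilde f(x)$, $\mu_{\mathcal D}=\lambda_{\min}(\mathbb E[\mathbf S^\top\mathbf S])$, and $L_{\mathbf S}^{\max}$ the smallest constant with $\lambda_{\max}(\mathbf S^\top\mathbf S)\le L_{\mathbf S}^{\max}$ a.s. Double Sketched GD: given $x^0\in\mathbb R^d$, for $t\ge0$ draw $\mathbf S^t\sim\mathcal D$ independently of the past and set $x^{t+1}=x^t-\gamma(\mathbf S^t)^\top\nabla f(s+\mathbf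 S^t(x^t-s))$. $f$ is $L_f$-smooth if differentiable, $f(x+h)\le f(x)+\langle\nabla f(x),h\rangle+\frac{L_f}{2}\|h\|^2$ for all $x,h$, and bounded below by $f^{\inf}$; $\mu_f$-strongly convex if $f(x+h)\ge f(x)+\langle\nabla f(x),h\rangle+\frac{\mu_f}{2}\|h\|^2$ for all $x,h$. *)

(* Defs.v *)
From HB Require Import structures.
From mathcomp Require Import all_boot all_order all_algebra.
From mathcomp Require Import all_classical all_reals all_analysis.
Set Implicit Arguments. Unset Strict Implicit. Unset Printing Implicit Defensive.
Import Order.TTheory GRing.Theory Num.Theory.
Import numFieldNormedType.Exports.
Local Open Scope classical_set_scope.
Local Open Scope ring_scope.

Definition dotv (R : realType) (n : nat) (u v : 'cV[R]_n) : R :=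
  \sum_(i < n) u i 0 * v i 0.
Definition sqnorm (R : realType) (n : nat) (v : 'cV[R]_n) : R := dotv v v.

Definition lambda_min (R : realType) (n : nat) (M : 'M[R]_n) : R :=
  inf [set a : R | eigenvalue M a].
Definition lambda_max (R : realType) (n : nat) (M : 'M[R]_n) : R :=
  sup [set a : R | eigenvalue M a].

Definition is_gradient (R : realType) (n : nat) (f : 'cV[R]_n -> R)
  (gf : 'cV[R]_n -> 'cV[R]_n) : Prop :=
  (forall x, differentiable f x) /\ (forall x v, 'D_v f x = dotv (gf x) v).

Definition L_smooth (R : realType) (n : nat) (f : 'cV[R]_n -> R)
  (gf : 'cV[R]_n -> 'cV[R]_n) (L : R) : Prop :=
  is_gradient f gf /\ has_lbound (range f) /\
  forall x h, f (x + h) <= f x + dotv (gf x) h + L / 2 * sqnorm h.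

Definition strongly_convex (R : realType) (n : nat) (f : 'cV[R]_n -> R)
  (gf : 'cV[R]_n -> 'cV[R]_n) (mu : R) : Prop :=
  is_gradient f gf /\
  forall x h, f x + dotv (gf x) h + mu / 2 * sqnorm h <= f (x + h).

Section Sketch.
Context (R : realType) (dT : measure_display) (T : measurableType dT)
  (P : probability T R) (n : nat) (S : T -> 'M[R]_n).

(* random matrix S (drawn with distribution D = law of S under P) *)
Definition EStS : 'M[R]_n :=
  \matrix_(i, j) fine (\int[P]_w ((S w)^T *m S w) i j)%:E.

Definition mu_D : R := lambda_min EStS.

Definition LS_max : R :=
  inf [set L : R | {ae P, forall w, lambda_max ((S w)^T *m S w) <= L}].

Definition f_S (f : 'cV[R]_n -> R) (s : 'cV[R]_n) (M : 'M[R]_n) x : R :=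
  f (s + M *m (x - s)).

Definition ftilde (f : 'cV[R]_n -> R) (s : 'cV[R]_n) (x : 'cV[R]_n) : R :=
  fine (\int[P]_w (f_S f s (S w) x)%:E).

Definition dsgd_step (gf : 'cV[R]_n -> 'cV[R]_n) (s : 'cV[R]_n) (gamma : R)
  (x : 'cV[R]_n) (M : 'M[R]_n) : 'cV[R]_n :=
  x - gamma *: (M^T *m gf (s + M *m (x - s))).

Definition dsgd_iter gf s gamma (x0 : 'cV[R]_n) (ws : seq T) : 'cV[R]_n :=
  foldl (fun x w => dsgd_step gf s gamma x (S w)) x0 ws.

End Sketch.

(* Expectation over t i.i.d. samples w_0,...,w_{t-1} ~ P, as an iterated
   integral: Eiter P t h = E[h [:: w_0; ...; w_{t-1}]]. *)
Fixpoint Eiter (R : realType) (dT : measure_display) (T : measurableType dT)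
  (P : probability T R) (t : nat) (h : seq T -> \bar R) : \bar R :=
  match t with
  | 0 => h [::]
  | t'.+1 => (\int[P]_w Eiter P t' (fun l => h (w :: l)))%E
  end.

(* Main.v *)
Require Import Defs.
From HB Require Import structures.
From mathcomp Require Import all_boot all_order all_algebra.
From mathcomp Require Import all_classical all_reals all_analysis.
From mathcomp Require Import measurable_realfun.
From mathcomp Require Import ring lra.
Set Implicit Arguments. Unset Strict Implicit. Unset Printing Implicit Defensive.
Import Order.TTheory GRing.Theory Num.Theory.
Import numFieldNormedType.Exports.
Local Open Scope classical_set_scope.
Local Open Scope ring_scope.

(* Write f_S(x) = f(s + S(x - s)), L = L_f L_S^max, y for the minimizer of ftilde
   and x+ for the result of one step from x. Expanding |x+ - y|^2, strong
   convexity of f at s + S(x - s) bounds the cross term by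
   -2 gamma (f_S(x) - f_S(y)) - gamma mu_f |S(x - y)|^2, while almost surely
   |S^T grad f|^2 <= L_S^max |grad f|^2 <= 2 L (f_S(x) - f^inf).
   Since E|S v|^2 >= mu_D |v|^2, taking expectations and using gamma L <= 1
   together with the minimality of y gives
     E|x+ - y|^2 <= (1 - gamma mu_D mu_f) |x - y|^2
                    + 2 gamma^2 L (ftilde^inf - f^inf),
   and iterating this sums the errors in a geometric series. *)

(** * Inner product, quadratic forms and extreme eigenvalues of symmetric matrices *)

Section InnerProduct.
Context (R : realType) (n : nat).
Implicit Types (u v w : 'cV[R]_n) (M : 'M[R]_n).

Lemma dotvE u v : dotv u v = (u^T *m v) 0 0.
Proof. by rewrite mxE; apply: eq_bigr => i _; rewrite mxE. Qed.

Lemma dotvC u v : dotv u v = dotv v u.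
Proof. by apply: eq_bigr => i _; rewrite mulrC. Qed.

Lemma dotvDr u v w : dotv u (v + w) = dotv u v + dotv u w.
Proof. by rewrite !dotvE mulmxDr mxE. Qed.

Lemma dotvDl u v w : dotv (u + v) w = dotv u w + dotv v w.
Proof. by rewrite dotvC dotvDr dotvC (dotvC v). Qed.

Lemma dotvZr a u v : dotv u (a *: v) = a * dotv u v.
Proof. by rewrite !dotvE -scalemxAr mxE. Qed.

Lemma dotvZl a u v : dotv (a *: u) v = a * dotv u v.
Proof. by rewrite dotvC dotvZr dotvC. Qed.

Lemma dotvNr u v : dotv u (- v) = - dotv u v.
Proof. by rewrite -scaleN1r dotvZr mulN1r. Qed.

Lemma dotvNl u v : dotv (- u) v = - dotv u v.
Proof. by rewrite dotvC dotvNr dotvC. Qed.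

Lemma dotv_mulmx M u v : dotv u (M *m v) = dotv (M^T *m u) v.
Proof. by rewrite !dotvE trmx_mul trmxK mulmxA. Qed.

Lemma dotv_form M v : dotv v (M *m v) = \sum_i \sum_j M i j * (v i 0 * v j 0).
Proof.
apply: eq_bigr => i _; rewrite mxE mulr_sumr.
by apply: eq_bigr => j _; rewrite mulrCA.
Qed.

Lemma sqnorm_mulmx M v : sqnorm (M *m v) = dotv v ((M^T *m M) *m v).
Proof. by rewrite /sqnorm dotv_mulmx dotvC mulmxA. Qed.

Lemma sqnorm_ge0 v : 0 <= sqnorm v.
Proof. by apply: sumr_ge0 => i _; rewrite -expr2 sqr_ge0. Qed.

Lemma sqr_coord_le_sqnorm v i : v i 0 ^+ 2 <= sqnorm v.
Proof.
rewrite /sqnorm /dotv (bigD1 i) //= expr2 lerDl.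
by apply: sumr_ge0 => j _; rewrite -expr2 sqr_ge0.
Qed.

Lemma sqnorm_eq0 v : sqnorm v = 0 -> v = 0.
Proof.
move=> v0; apply/colP => i; rewrite mxE; apply/eqP.
by rewrite -sqrf_eq0 eq_le sqr_ge0 -v0 sqr_coord_le_sqnorm.
Qed.

Lemma sqnorm_const1_gt0 : (0 < n)%N -> 0 < sqnorm (const_mx 1 : 'cV[R]_n).
Proof.
move=> n0; have := sqr_coord_le_sqnorm (const_mx 1) (Ordinal n0).
by rewrite mxE; lra.
Qed.

Lemma sqnormB u v : sqnorm (u - v) = sqnorm u - 2 * dotv u v + sqnorm v.
Proof.
by rewrite /sqnorm dotvDl !dotvDr !dotvNl !dotvNr (dotvC v u); ring.
Qed.

Lemma sqnormZ a v : sqnorm (a *: v) = a ^+ 2 * sqnorm v.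
Proof. by rewrite /sqnorm dotvZl dotvZr mulrA expr2. Qed.

(** Each product [v i 0 * v j 0] is at most [sqnorm v] in absolute value, so the sum of the
    [|M i j|] serves as [C]; only its finiteness matters later. *)
Lemma form_bounded M : exists2 C, 0 <= C &
  forall v, `|dotv v (M *m v)| <= C * sqnorm v.
Proof.
exists (\sum_i \sum_j `|M i j|).
  by apply: sumr_ge0 => i _; apply: sumr_ge0.
move=> v; rewrite dotv_form (le_trans (ler_norm_sum _ _ _)) // mulr_suml.
apply: ler_sum => i _; rewrite (le_trans (ler_norm_sum _ _ _)) // mulr_suml.
apply: ler_sum => j _; rewrite normrM ler_wpM2l //.
have := sqr_coord_le_sqnorm v i; have := sqr_coord_le_sqnorm v j.
by case: (lerP 0 (v i 0 * v j 0)) => [/ger0_norm|/ltr0_norm] ->; nra.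
Qed.

Lemma cauchy_schwarz_form M : M^T = M ->
  (forall v, 0 <= dotv v (M *m v)) ->
  forall u v, dotv u (M *m v) ^+ 2 <= dotv u (M *m u) * dotv v (M *m v).
Proof.
move=> symM M0 u v.
have expand a b : 0 <= a ^+ 2 * dotv u (M *m u)
    + 2 * a * b * dotv u (M *m v) + b ^+ 2 * dotv v (M *m v).
  have := M0 (a *: u + b *: v).
  rewrite mulmxDr -!scalemxAr dotvDl !dotvDr !dotvZl !dotvZr.
  have -> : dotv v (M *m u) = dotv u (M *m v) by rewrite dotv_mulmx symM dotvC.
  by move/le_trans; apply; rewrite le_eqVlt; apply/orP; left; apply/eqP; ring.
have := M0 u; have := M0 v; move: expand.
move: (dotv u (M *m u)) (dotv u (M *m v)) (dotv v (M *m v)) => x y z ex z0 x0.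
have [z_eq0|z_gt0] : z = 0 \/ 0 < z by lra.
  (* With [z = 0] these coefficients leave [- y ^+ 2 * (x + 2) >= 0], which forces [y = 0]. *)
  by have := ex (- y) (x + 1); rewrite z_eq0; nra.
have : 0 <= z * (x * z - y ^+ 2) by have := ex z (- y); nra.
by rewrite pmulr_rge0 // subr_ge0.
Qed.

Lemma cauchy_schwarz u v : dotv u v ^+ 2 <= sqnorm u * sqnorm v.
Proof.
have := @cauchy_schwarz_form 1%:M (trmx1 _ _) _ u v.
by rewrite !mul1mx; apply => w; rewrite mul1mx sqnorm_ge0.
Qed.

(** For [w = M^T v], Cauchy-Schwarz on [|w|^2 = <v, M w>] gives [|w|^4 <= c |v|^2 |w|^2], and one
    divides by [|w|^2]. This transfers a bound on the sketch to the transpose that multiplies the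
    gradient. *)
Lemma sqnorm_trmx_le M c :
  (forall v, sqnorm (M *m v) <= c * sqnorm v) ->
  forall v, sqnorm (M^T *m v) <= c * sqnorm v.
Proof.
move=> Mc v; set w := M^T *m v.
have ww : sqnorm w = dotv v (M *m w) by rewrite dotv_mulmx.
have := cauchy_schwarz v (M *m w); rewrite -ww => cs.
have := Mc w; have := sqnorm_ge0 w; have := sqnorm_ge0 v.
have [w0|wn0] := eqVneq (sqnorm w) 0.
  have := Mc v; have := sqnorm_ge0 (M *m v); lra.
move=> v0 w0 Mw; have {wn0 w0}w0 : 0 < sqnorm w by rewrite lt_neqAle eq_sym wn0.
rewrite -(ler_pM2l w0) -expr2 (le_trans cs) //; nra.
Qed.

Lemma eigenvalue_unitmx M a : eigenvalue M a = (M - a%:M \notin unitmx).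
Proof. by rewrite /eigenvalue kermx_eq0 row_free_unit. Qed.

(** [eigenvalue] speaks of row vectors; symmetry allows an eigenvector to be transposed into a
    column. *)
Lemma eigenvalue_form M a : M^T = M -> eigenvalue M a ->
  exists2 v, 0 < sqnorm v & dotv v (M *m v) = a * sqnorm v.
Proof.
move=> symM /eigenvalueP[v vM v0]; exists v^T.
  rewrite lt_neqAle sqnorm_ge0 andbT eq_sym; apply: contra_neq v0.
  by move/sqnorm_eq0 => v0; rewrite -[v]trmxK v0 trmx0.
have -> : M *m v^T = a *: v^T by rewrite -{1}symM -trmx_mul vM linearZ.
by rewrite dotvZr.
Qed.

(* With q the best constant in q |v|^2 <= <v, M v>, the form A = M - q is
   nonnegative, so Cauchy-Schwarz for it gives |A v|^2 <= C <v, A v>; were A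
   invertible, q could be increased. *)
Lemma symmetric_min_eigenvalue M : (0 < n)%N -> M^T = M ->
  exists2 q, eigenvalue M q & forall v, q * sqnorm v <= dotv v (M *m v).
Proof.
move=> n0 symM.
pose E := [set c : R | forall v, c * sqnorm v <= dotv v (M *m v)].
have [C C0 MC] := form_bounded M.
have EC : E (- C).
  by move=> v; have := MC v; rewrite ler_norml mulNr => /andP[].
have Eub v : 0 < sqnorm v -> ubound E (dotv v (M *m v) / sqnorm v).
  by move=> v0 c Ec; rewrite ler_pdivlMr.
have supE : has_sup E.
  split; first by exists (- C).
  pose e : 'cV[R]_n := const_mx 1.
  exists (dotv e (M *m e) / sqnorm e); apply: Eub.
  exact: sqnorm_const1_gt0.
have Eq : E (sup E).
  move=> v; have [v0|v0] := eqVneq (sqnorm v) 0.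
    by rewrite v0 mulr0 (sqnorm_eq0 v0) mulmx0 dotvE mulmx0 mxE.
  have {}v0 : 0 < sqnorm v by rewrite lt_neqAle eq_sym v0 sqnorm_ge0.
  by rewrite -ler_pdivlMr // ge_sup //; [case: supE|exact: Eub].
exists (sup E) => //; rewrite eigenvalue_unitmx; apply/negP.
set A := M - _ => unitA.
have formA v : dotv v (A *m v) = dotv v (M *m v) - sup E * sqnorm v.
  by rewrite mulmxBl mul_scalar_mx dotvDr dotvNr dotvZr.
have A0 v : 0 <= dotv v (A *m v) by rewrite formA subr_ge0.
have symA : A^T = A by rewrite linearB /= symM tr_scalar_mx.
have [C1 C10 AC1] := form_bounded A.
have [C2 C20 AC2] := form_bounded ((invmx A)^T *m invmx A).
have A1 v : sqnorm (A *m v) <= C1 * dotv v (A *m v).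
  have := cauchy_schwarz_form symA A0 (A *m v) v.
  have := AC1 (A *m v); rewrite ger0_norm //.
  have := A0 v; have := sqnorm_ge0 (A *m v).
  have -> : dotv (A *m v) (A *m v) = sqnorm (A *m v) by [].
  have [->|n0'] := eqVneq (sqnorm (A *m v)) 0; first by rewrite mulr_ge0.
  move=> w0 d0 d1 cs; have w1 : 0 < sqnorm (A *m v) by rewrite lt_neqAle eq_sym n0'.
  by rewrite -(ler_pM2l w1) -expr2 (le_trans cs) //; nra.
(* [C2] bounds the inverse: [|v|^2 <= C2 |A v|^2 <= C2 C1 <v, A v>]. Adding 1 makes the constant
   positive, so that its inverse is a genuine increment of [sup E]. *)
have A2 v : sqnorm v <= (C2 * C1 + 1) * dotv v (A *m v).
  have := AC2 (A *m v); rewrite -sqnorm_mulmx mulKmx // ger0_norm ?sqnorm_ge0 //.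
  by have := A1 v; have := A0 v; nra.
have k0 : 0 < C2 * C1 + 1 by nra.
have : E (sup E + (C2 * C1 + 1)^-1).
  move=> v; rewrite mulrDl -lerBrDl -formA mulrC ler_pdivrMr // mulrC.
  exact: A2.
move/(ub_le_sup (proj2 supE)); rewrite gerDl leNgt invr_gt0 k0 //.
Qed.

Lemma lambda_min_le_form M v : (0 < n)%N -> M^T = M ->
  lambda_min M * sqnorm v <= dotv v (M *m v).
Proof.
move=> n0 symM; have [q Mq qle] := symmetric_min_eigenvalue n0 symM.
apply: le_trans (qle v); rewrite ler_wpM2r ?sqnorm_ge0 //.
apply: ge_inf => //; exists q => a /(eigenvalue_form symM)[w w0 ww].
by rewrite -(ler_pM2r w0) -ww.
Qed.

(** The least eigenvalue of [- M] is the opposite of an eigenvalue of [M] that dominates the form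
    and hence all other eigenvalues. *)
Lemma form_le_lambda_max M v : (0 < n)%N -> M^T = M ->
  dotv v (M *m v) <= lambda_max M * sqnorm v.
Proof.
move=> n0 symM; have symN : (- M)^T = - M by rewrite linearN /= symM.
have [q Nq qle] := symmetric_min_eigenvalue n0 symN.
have Mq : eigenvalue M (- q).
  move: Nq; rewrite !eigenvalue_unitmx; apply: contra => U.
  have -> : - M - q%:M = - (M - (- q)%:M).
    by apply/matrixP => i j; rewrite !mxE mulNrn; ring.
  by rewrite -scaleN1r unitmxZ // unitrN1.
have := qle v; rewrite mulNmx dotvNr lerNr -mulNr => /le_trans; apply.
rewrite ler_wpM2r ?sqnorm_ge0 //; apply: ub_le_sup => //.
exists (- q) => a /(eigenvalue_form symM)[w w0 ww].
by rewrite -(ler_pM2r w0) -ww mulNr lerNr -dotvNr -mulNmx.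
Qed.

End InnerProduct.

(** * Integral comparison without measurability; continuous functions of random vectors *)

Section Integration.
Context (R : realType) (dT : measure_display) (T : measurableType dT).

(** The integral of a nonnegative function is a supremum over the simple functions below it, and
    enlarging the function only enlarges that family. *)
Lemma ge0_le_integral_nonmeasurable (mu : {measure set T -> \bar R})
    (f g : T -> \bar R) :
  (forall x, 0 <= f x)%E -> (forall x, f x <= g x)%E ->
  (\int[mu]_x f x <= \int[mu]_x g x)%E.
Proof.
move=> f0 fg; have g0 x : (0 <= g x)%E by rewrite (le_trans (f0 x)).
rewrite !ge0_integralE// !patch_setT.
apply: ge_ereal_sup => _ [h hf <-]; apply: ereal_sup_ubound.
by exists h => // x; exact: le_trans (fg x).
Qed.

(* [f] need not be measurable: on a measurable null set containing the
   exceptional points the bound is replaced by [+oo]. *)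
Lemma ge0_le_integral_ae (mu : {measure set T -> \bar R})
    (f : T -> \bar R) (B : T -> R) :
  mu.-integrable setT (EFin \o B) -> (forall x, 0 <= f x)%E ->
  {ae mu, forall x, (f x <= (B x)%:E)%E} ->
  (\int[mu]_x f x <= \int[mu]_x (B x)%:E)%E.
Proof.
move=> iB f0 [N [mN N0 subN]].
pose B' : T -> \bar R := fun x => if x \in N then +oo%E else (B x)%:E.
have mB' : measurable_fun setT B'.
  apply: measurable_fun_ifT.
  - by apply: (measurable_fun_bool true); rewrite setTI preimage_mem_true.
  - exact: measurable_cst.
  - exact: measurable_int iB.
rewrite (_ : \int[mu]_x (B x)%:E = \int[mu]_x B' x)%E.
  apply: ge0_le_integral_nonmeasurable => // x; rewrite /B'.
  have [|xN] := boolP (x \in N); first by rewrite leey.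
  apply: contrapT => nfB; move/negP: xN; apply; rewrite inE; exact: subN.
apply: ae_eq_integral => //; first exact: measurable_int iB.
exists N; split=> // x /=; apply: contra_notP => xN _.
by rewrite /B' memNset.
Qed.

(** The open set where [g] exceeds [r] is a countable union of boxes with rational centres and radii
    [1/(k+1)]; the preimage of a box is a finite intersection of conditions on coordinates. *)
Lemma measurable_continuous_cV n (g : 'cV[R]_n -> R) (h : T -> 'cV[R]_n) :
  continuous g -> (forall i, measurable_fun setT (fun w => h w i 0)) ->
  measurable_fun setT (fun w => g (h w)).
Proof.
move=> cg mh.
apply: (measurability _ (RGenOInfty.measurableE R)).
move=> _ [_ [r ->] <-]; rewrite setTI.
pose box (p : 'cV[rat]_n * nat) : set 'cV[R]_n :=
  [set y | forall i, `|ratr (p.1 i 0) - y i 0| < p.2.+1%:R^-1].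
have mbox p : measurable (h @^-1` box p).
  rewrite (_ : h @^-1` _ = \bigcap_(i in [set: 'I_n])
      [set w | `|ratr (p.1 i 0) - h w i 0| < p.2.+1%:R^-1]).
    apply: fin_bigcap_measurable => // i _.
    have mi : measurable_fun setT (fun w => `|ratr (p.1 i 0) - h w i 0|).
      apply: measurableT_comp => //; apply: measurable_funB => //.
    have := mi measurableT _ (measurable_itv `]-oo, p.2.+1%:R^-1[).
    rewrite setTI; congr (measurable _); apply/seteqP; split=> w /=;
      by rewrite in_itv.
  by apply/seteqP; split=> w /= H i; [move=> _|]; exact: H.
rewrite (_ : _ @^-1` _ = \bigcup_(p in [set: 'cV[rat]_n * nat])
    (if `[< box p `<=` [set y | r < g y] >] then h @^-1` box p else set0)).
  apply: countable_bigcupT_measurable => [|p]; first exact: countableP.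
  by case: ifP.
apply/seteqP; split=> w /=; last first.
  move=> [p _]; case: ifPn => // /asboolP sub /sub /=.
  by rewrite in_itv /= andbT.
rewrite in_itv /= andbT => rg.
have : nbhs (h w) [set y | r < g y] by exact: (cg (h w)) (lt_nbhsr rg).
move=> /nbhs_ballP[e /= e0 sub].
(* A box of radius below [e / 2] whose centre is that close to [h w] stays within the ball of radius
   [e]. *)
have [k ke] : exists k, k.+1%:R^-1 < e / 2.
  have e20 : 0 < e / 2 by rewrite divr_gt0.
  have := near_infty_natSinv_lt (PosNum e20) => -[k _ /(_ k (leqnn k))] /=.
  by exists k.
have k0 : 0 < k.+1%:R^-1 :> R by rewrite invr_gt0.
have /choice[q qP] : forall i, exists q : rat, `|ratr q - h w i 0| < k.+1%:R^-1.
  move=> i; have : h w i 0 - k.+1%:R^-1 < h w i 0 + k.+1%:R^-1 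
    by rewrite ltrBlDr -addrA ltrDl addr_gt0.
  move=> /rat_in_itvoo[q]; rewrite in_itv /= => qi; exists q.
  by rewrite ltr_distl.
pose p : 'cV[rat]_n * nat := (\col_i q i, k).
exists p => //; rewrite ifT; first by move=> i; rewrite mxE.
apply/asboolP => y ybox; apply: sub; split => // i j; rewrite (ord1 j).
rewrite /ball /=; have := qP i; have := ybox i; rewrite mxE distrC => a b.
rewrite distrC -(subrK (ratr (q i)) (y i 0)) -addrA.
by rewrite (le_lt_trans (ler_normD _ _)) // (splitr e) ltrD // (lt_trans _ ke).
Qed.

End Integration.

(** * Linearity for real-valued integrands *)

Section RealIntegrals.
Context (R : realType) (dT : measure_display) (T : measurableType dT).
Context (mu : {measure set T -> \bar R}).

Lemma integrable_EFinZl (c : R) (F : T -> R) :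
  mu.-integrable setT (EFin \o F) ->
  mu.-integrable setT (EFin \o (fun w => c * F w)).
Proof. by move=> iF; apply: (integrableZl measurableT c iF). Qed.

Lemma integrable_EFinD (F G : T -> R) :
  mu.-integrable setT (EFin \o F) -> mu.-integrable setT (EFin \o G) ->
  mu.-integrable setT (EFin \o (fun w => F w + G w)).
Proof. by move=> iF iG; apply: (integrableD measurableT iF iG). Qed.

Lemma integrable_Rsum (I : Type) (r : seq I) (F : I -> T -> R) :
  (forall i, mu.-integrable setT (EFin \o F i)) ->
  mu.-integrable setT (EFin \o (fun w => \sum_(i <- r) F i w)).
Proof.
move=> iF; rewrite (_ : _ \o _ = fun w => (\sum_(i <- r) (F i w)%:E)%E).
  by apply: (integrable_sum measurableT) => i _; exact: iF.
by apply/funext => w /=; rewrite sumEFin.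
Qed.

Lemma Rintegral_sum (I : Type) (r : seq I) (F : I -> T -> R) :
  (forall i, mu.-integrable setT (EFin \o F i)) ->
  \int[mu]_w (\sum_(i <- r) F i w) = \sum_(i <- r) \int[mu]_w F i w.
Proof.
move=> iF; elim: r => [|i r IH].
  by under eq_Rintegral do rewrite big_nil; rewrite Rintegral_cst // mul0r big_nil.
rewrite big_cons -IH -RintegralD //; last exact: integrable_Rsum.
by apply: eq_Rintegral => w _; rewrite big_cons.
Qed.

End RealIntegrals.

(** * Iterated expectations under a drift condition *)

Section Iteration.
Context (R : realType) (dT : measure_display) (T : measurableType dT).
Context (P : probability T R).

Lemma Eiter_ge0 t (h : seq T -> \bar R) :
  (forall l, 0 <= h l)%E -> (0 <= Eiter P t h)%E.
Proof.
elim: t h => [|t IH] h h0 /=; first exact: h0.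
by apply: integral_ge0 => w _; apply: IH.
Qed.

(* The drift condition bounds the conditional expectation of [V] after a step
   by [a * V x + (1 - a) * c]; it is phrased through a dominating integrable
   function because [V (step x w)] is not assumed to be measurable in [w]. *)
Lemma Eiter_foldl_drift (X : Type) (step : X -> T -> X) (V : X -> R) (a c : R) :
  0 <= a -> 0 <= c -> (forall x, 0 <= V x) ->
  (forall x, exists B : T -> R, [/\ P.-integrable setT (EFin \o B),
     {ae P, forall w, V (step x w) <= B w} &
     \int[P]_w B w <= a * V x + (1 - a) * c]) ->
  forall t x, (Eiter P t (fun ws => (V (foldl step x ws))%:E)
    <= (a ^+ t * V x + (1 - a ^+ t) * c)%:E)%E.
Proof.
move=> a0 c0 V0 drift; elim=> [|t IH] x /=.
  by rewrite expr0 mul1r subrr mul0r addr0.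
have [B [iB VB EB]] := drift x.
(* The first sample is peeled off: [D] is the induction bound started at [step x w], with
   [V (step x w)] replaced by [B w]. *)
pose D w := (1 - a ^+ t) * c + a ^+ t * B w.
have i1 : P.-integrable setT (EFin \o (fun=> (1 - a ^+ t) * c)).
  exact: finite_measure_integrable_cst.
have i2 : P.-integrable setT (EFin \o (fun w => a ^+ t * B w)).
  exact: integrable_EFinZl.
have iD : P.-integrable setT (EFin \o D) by apply: (integrableD measurableT i1 i2).
apply: (@le_trans _ _ (\int[P]_w (D w)%:E)%E).
  apply: ge0_le_integral_ae => //.
    by move=> w; apply: Eiter_ge0 => l; rewrite lee_fin.
  apply: filterS VB => w VB; apply: le_trans (IH _) _.
  by rewrite lee_fin addrC lerD2l ler_wpM2l // exprn_ge0.
rewrite -[leLHS]fineK; last exact: integrable_fin_num.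
rewrite lee_fin -/(Rintegral P setT D) RintegralD // RintegralZl //.
rewrite Rintegral_cst //= [X in fine X](@probability_setT _ _ _ P) mulr1.
have := ler_wpM2l (exprn_ge0 t a0) EB; rewrite exprSr; lra.
Qed.

End Iteration.

(** * Second moment and almost sure norm bound of the sketch *)

Section SketchMoments.
Context (R : realType) (dT : measure_display) (T : measurableType dT).
Context (P : probability T R) (n : nat) (S : T -> 'M[R]_n).

Context (iSS : forall i j,
  P.-integrable setT (fun w => (((S w)^T *m S w) i j)%:E)).

Lemma integrable_sqnorm_sketch v :
  P.-integrable setT (EFin \o (fun w => sqnorm (S w *m v))).
Proof.
under eq_fun do rewrite /= sqnorm_mulmx dotv_form.
apply: integrable_Rsum => i; apply: integrable_Rsum => j.
under eq_fun do rewrite /= mulrC.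
by apply: integrable_EFinZl; exact: iSS.
Qed.

Lemma Rintegral_sqnorm_sketch v :
  \int[P]_w sqnorm (S w *m v) = dotv v (EStS P S *m v).
Proof.
under eq_Rintegral do rewrite sqnorm_mulmx dotv_form.
have iij i j : P.-integrable setT
    (EFin \o (fun w => ((S w)^T *m S w) i j * (v i 0 * v j 0))).
  under eq_fun do rewrite /= mulrC.
  by apply: integrable_EFinZl; exact: iSS.
rewrite Rintegral_sum => [|i]; last exact: integrable_Rsum.
rewrite dotv_form; apply: eq_bigr => i _; rewrite Rintegral_sum //.
apply: eq_bigr => j _; rewrite RintegralZr //; last exact: iSS.
by rewrite mxE.
Qed.

Lemma EStS_sym : (EStS P S)^T = EStS P S.
Proof.
apply/matrixP => i j; rewrite !mxE; apply: eq_Rintegral => w _.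
have /matrixP/(_ i j) : ((S w)^T *m S w)^T = (S w)^T *m S w.
  by rewrite trmx_mul trmxK.
by rewrite [LHS]mxE.
Qed.

Context (n_gt0 : (0 < n)%N).

Lemma mu_D_le_second_moment v :
  mu_D P S * sqnorm v <= \int[P]_w sqnorm (S w *m v).
Proof.
rewrite Rintegral_sqnorm_sketch; apply: lambda_min_le_form => //.
exact: EStS_sym.
Qed.

Context (bndS :
  exists L : R, {ae P, forall w, lambda_max ((S w)^T *m S w) <= L}).

(** The infimum defining [LS_max] is itself an almost sure bound: the bounds [LS_max + 1/(k+1)] hold
    simultaneously off a countable union of null sets. The exceptional set does not depend on
    [v]. *)
Lemma sketch_le_LS_max :
  {ae P, forall w v, sqnorm (S w *m v) <= LS_max P S * sqnorm v}.
Proof.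
have symSS w : ((S w)^T *m S w)^T = (S w)^T *m S w by rewrite trmx_mul trmxK.
have lmax0 w : 0 <= lambda_max ((S w)^T *m S w).
  pose e : 'cV[R]_n := const_mx 1.
  have e0 : 0 < sqnorm e by exact: sqnorm_const1_gt0.
  rewrite -(pmulr_lge0 _ e0); apply: le_trans (form_le_lambda_max e n_gt0 _) => //.
  by rewrite -sqnorm_mulmx sqnorm_ge0.
have infE : has_inf [set L : R |
    {ae P, forall w, lambda_max ((S w)^T *m S w) <= L}].
  split; first by case: bndS => L; exists L.
  (* Since every [lambda_max] here is nonnegative, a negative almost sure bound would make the whole
     space negligible. *)
  exists 0 => L LP; have [//|L0] := leP 0 L.
  have : P.-negligible [set: T].
    apply: negligibleS LP => w _ /=; apply/negP; rewrite -ltNge.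
    exact: lt_le_trans (lmax0 w).
  rewrite negligibleP // [X in X = _](@probability_setT _ _ _ P).
  by move=> /eqP; rewrite eqe oner_eq0.
have approx k : {ae P, forall w,
    lambda_max ((S w)^T *m S w) <= LS_max P S + k.+1%:R^-1}.
  have k0 : 0 < k.+1%:R^-1 :> R by rewrite invr_gt0.
  have [L LP Lk] := inf_adherent k0 infE.
  by apply: filterS LP => w /le_trans; apply; exact: ltW.
apply: filterS (ae_foralln approx) => w Lw v.
rewrite sqnorm_mulmx (le_trans (form_le_lambda_max v n_gt0 _)) //.
rewrite ler_wpM2r ?sqnorm_ge0 //; apply/ler_addgt0Pr => e e0.
have [k _ /(_ k (leqnn k)) /= ke] := near_infty_natSinv_lt (PosNum e0).
by apply: le_trans (Lw k) _; rewrite lerD2l ltW.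
Qed.

(** Both constants are compared with the second moment at the all-ones vector. This yields
    [0 < LS_max] and helps keep the contraction factor nonnegative. *)
Lemma mu_D_le_LS_max : mu_D P S <= LS_max P S.
Proof.
pose e : 'cV[R]_n := const_mx 1.
have e0 : 0 < sqnorm e by exact: sqnorm_const1_gt0.
rewrite -(ler_pM2r e0); apply: le_trans (mu_D_le_second_moment e) _.
rewrite -lee_fin /Rintegral fineK; last first.
  by apply: integrable_fin_num => //; exact: integrable_sqnorm_sketch.
rewrite (_ : (_ * _)%:E = \int[P]_w (LS_max P S * sqnorm e)%:E)%E.
  apply: ge0_le_integral_ae.
  - exact: finite_measure_integrable_cst.
  - by move=> w; rewrite lee_fin sqnorm_ge0.
  - by apply: filterS sketch_le_LS_max => w /(_ e).
by rewrite integral_cst // [X in (_ * X)%E](@probability_setT _ _ _ P) mule1.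
Qed.

End SketchMoments.

(** * Deterministic estimate for one step with a fixed sketch *)

Section SketchedStep.
Context (R : realType) (n : nat).
Context (f : 'cV[R]_n -> R) (gf : 'cV[R]_n -> 'cV[R]_n) (Lf muf : R).
Context (smoothf : L_smooth f gf Lf) (scf : strongly_convex f gf muf).

Lemma inf_range_le y : inf (range f) <= f y.
Proof. by case: smoothf => _ [lbf _]; apply: ge_inf => //; exists y. Qed.

Lemma strong_convexity_le_smoothness : (0 < n)%N -> muf <= Lf.
Proof.
move=> n0; pose e : 'cV[R]_n := const_mx 1.
have e0 : 0 < sqnorm e by exact: sqnorm_const1_gt0.
case: smoothf => _ [_ /(_ 0 e) up]; case: scf => _ /(_ 0 e) low.
by rewrite -(ler_pM2r e0); lra.
Qed.

(** A gradient step of length [1 / Lf] decreases [f] by at least [|gf y|^2 / (2 Lf)], yet cannot go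
    below the infimum. *)
Lemma sqnorm_gradient_le y : 0 < Lf ->
  sqnorm (gf y) <= 2 * Lf * (f y - inf (range f)).
Proof.
move=> L0; case: smoothf => _ [_ /(_ y (- Lf^-1 *: gf y))].
rewrite dotvZr sqnormZ -/(sqnorm (gf y)) => up.
have := le_trans (inf_range_le _) up.
rewrite (_ : Lf / 2 * _ = Lf^-1 / 2 * sqnorm (gf y)); last first.
  by field; rewrite gt_eqF.
move=> {}up.
rewrite -(ler_pM2l (_ : 0 < Lf^-1 / 2)) ?divr_gt0 ?invr_gt0 //.
rewrite (_ : _ * (2 * Lf * _) = f y - inf (range f)); last first.
  by field; rewrite gt_eqF.
lra.
Qed.

Lemma dsgd_step_sqdist (s x y : 'cV[R]_n) (M : 'M[R]_n) (gamma c : R) :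
  0 < Lf -> 0 < gamma -> 0 <= c ->
  (forall v, sqnorm (M *m v) <= c * sqnorm v) ->
  sqnorm (dsgd_step gf s gamma x M - y) <=
    sqnorm (x - y) - 2 * gamma * (f_S f s M x - f_S f s M y)
    - gamma * muf * sqnorm (M *m (x - y))
    + 2 * gamma ^+ 2 * (Lf * c) * (f_S f s M x - inf (range f)).
Proof.
move=> L0 g0 c0 /sqnorm_trmx_le Mc; rewrite /dsgd_step /f_S.
set z := s + M *m (x - s).
rewrite [x - _ - y]addrAC [leLHS]sqnormB dotvZr sqnormZ dotv_mulmx trmxK.
(* This displacement leads from [z] to [s + M (y - s)], the point where [f_S] at [y] evaluates
   [f]. *)
case: scf => _ /(_ z (- (M *m (x - y)))).
rewrite dotvNr [sqnorm (- _)]/sqnorm dotvNl dotvNr opprK -/(sqnorm _).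
rewrite (_ : z - _ = s + M *m (y - s)); last first.
  by rewrite -addrA -mulmxBr opprB [x - s + _]addrC addrA subrK.
rewrite [dotv (M *m _) _]dotvC => sc.
have grad : sqnorm (M^T *m gf z) <= 2 * (Lf * c) * (f z - inf (range f)).
  apply: le_trans (Mc _) _; have := ler_wpM2l c0 (sqnorm_gradient_le z L0).
  by move=> /le_trans; apply; rewrite le_eqVlt; apply/orP; left; apply/eqP; ring.
have g20 : 0 <= gamma ^+ 2 by rewrite sqr_ge0.
have := ler_wpM2l g20 grad; have := ler_wpM2l (ltW g0) sc; lra.
Qed.

End SketchedStep.

(** * Integrability and lower bound of the sketched objective *)

Section SketchedObjective.
Context (R : realType) (dT : measure_display) (T : measurableType dT).
Context (P : probability T R) (n : nat) (S : T -> 'M[R]_n).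
Context (f : 'cV[R]_n -> R) (gf : 'cV[R]_n -> 'cV[R]_n) (Lf : R).
Context (mS : forall i j, measurable_fun setT (fun w => S w i j)).
Context (iS : forall i j, P.-integrable setT (fun w => (S w i j)%:E)).
Context (iSS : forall i j,
  P.-integrable setT (fun w => (((S w)^T *m S w) i j)%:E)).
Context (smoothf : L_smooth f gf Lf).

Lemma integrable_dotv_sketch u v :
  P.-integrable setT (EFin \o (fun w => dotv u (S w *m v))).
Proof.
apply: integrable_Rsum => i; apply: integrable_EFinZl.
under eq_fun do rewrite /= mxE; apply: integrable_Rsum => j.
under eq_fun do rewrite /= mulrC; apply: integrable_EFinZl; exact: iS.
Qed.

(** The integrand lies between the infimum of [f] and the quadratic upper bound [U] from smoothness
    at [s], which is integrable by the first and second moments of [S]. *)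
Lemma integrable_f_S s x :
  P.-integrable setT (EFin \o (fun w => f_S f s (S w) x)).
Proof.
have mf : measurable_fun setT (fun w => f_S f s (S w) x).
  apply: measurable_continuous_cV => [y|i].
    by case: smoothf => -[df _] _; apply: differentiable_continuous.
  under eq_fun do rewrite !mxE.
  apply: measurable_funD => //; apply: measurable_sum => j.
  by apply: measurable_funM.
pose U w := f s + (dotv (gf s) (S w *m (x - s))
  + Lf / 2 * sqnorm (S w *m (x - s))).
have iU : P.-integrable setT (EFin \o U).
  apply: integrable_EFinD; first exact: finite_measure_integrable_cst.
  apply: integrable_EFinD; first exact: integrable_dotv_sketch.
  by apply: integrable_EFinZl; exact: integrable_sqnorm_sketch.
have iaU : P.-integrable setT (EFin \o (fun w => `|U w|)).
  exact: integrable_norm iU.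
have iG : P.-integrable setT
    (EFin \o (fun w => `|inf (range f)| + `|U w|)).
  by apply: integrable_EFinD => //; exact: finite_measure_integrable_cst.
apply: (le_integrable measurableT _ _ iG); first exact/measurable_EFinP.
move=> w _ /=; rewrite lee_fin [leRHS]ger0_norm ?addr_ge0 //.
have low : inf (range f) <= f_S f s (S w) x by exact: (inf_range_le smoothf).
have up : f_S f s (S w) x <= U w.
  by case: smoothf => _ [_ /(_ s (S w *m (x - s)))]; rewrite /U addrA.
move: (f_S _ _ _ _) (U w) (inf _) low up => y u m low up.
have := ler_norm u; have := ler_norm (- m); rewrite normrN ler_norml.
by have := normr_ge0 u; have := normr_ge0 m; lra.
Qed.

Lemma inf_range_le_ftilde s x : inf (range f) <= ftilde P S f s x.
Proof.
rewrite /ftilde -/(Rintegral P setT (fun w => f_S f s (S w) x)).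
rewrite (_ : inf _ = \int[P]_w (cst (inf (range f)) w)).
  apply: le_Rintegral => //.
  - exact: finite_measure_integrable_cst.
  - exact: integrable_f_S.
  - by move=> w _; exact: (inf_range_le smoothf).
by rewrite Rintegral_cst //= [X in fine X](@probability_setT _ _ _ P) mulr1.
Qed.

End SketchedObjective.

(** * Drift of the squared distance to the minimizer and the resulting bound *)

Theorem theorem2 (R : realType) (dT : measure_display) (T : measurableType dT)
  (P : probability T R) (n : nat) (S : T -> 'M[R]_n)
  (f : 'cV[R]_n -> R) (gf : 'cV[R]_n -> 'cV[R]_n) (Lf muf : R)
  (s x0 xstar : 'cV[R]_n) (gamma : R) :
  (* S is a random matrix with E[S] = I and E[S^T S] finite *)
  (forall i j, measurable_fun setT (fun w => S w i j)) ->
  (forall i j, P.-integrable setT (fun w => (S w i j)%:E)) ->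
  (forall i j, (\int[P]_w (S w i j)%:E = ((1%:M : 'M[R]_n) i j)%:E)%E) ->
  (forall i j, P.-integrable setT (fun w => (((S w)^T *m S w) i j)%:E)) ->
  (* f is L_f-smooth and mu_f-strongly convex *)
  L_smooth f gf Lf -> 0 < muf -> strongly_convex f gf muf ->
  (* L_S^max < oo *)
  (exists L : R, {ae P, forall w, lambda_max ((S w)^T *m S w) <= L}) ->
  0 < mu_D P S ->
  (* xstar minimizes ftilde *)
  (forall x, ftilde P S f s xstar <= ftilde P S f s x) ->
  0 < gamma -> gamma <= 1 / (Lf * LS_max P S) ->
  forall t : nat,
  (Eiter P t (fun ws => (sqnorm (dsgd_iter S gf s gamma x0 ws - xstar))%:E)
   <= ((1 - gamma * mu_D P S * muf) ^+ t * sqnorm (x0 - xstar)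
       + 2 * gamma * Lf * LS_max P S / (muf * mu_D P S)
         * (inf (range (ftilde P S f s)) - inf (range f)))%:E)%E.
Proof.
move=> mS iS _ iSS smoothf muf0 scf bndS muD0 xstar_min g0 gle t.
(* In dimension 0 there are no eigenvalues, so [mu_D] would be the infimum of the empty set, which
   is 0 by convention. *)
have n0 : (0 < n)%N.
  rewrite lt0n; apply/eqP => n0; move: muD0; rewrite /mu_D /lambda_min.
  rewrite (_ : [set a | _] = set0) ?inf0 ?ltxx //.
  apply/seteqP; split=> // a /eigenvalueP[v _ /eqP]; apply.
  by apply/rowP => i; have := ltn_ord i; rewrite [X in (_ < X)%N]n0.
have muL := strong_convexity_le_smoothness smoothf scf n0.
have L0 : 0 < Lf by exact: lt_le_trans muL.
have muLS := mu_D_le_LS_max iSS n0 bndS.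
have LS0 : 0 < LS_max P S by exact: lt_le_trans muLS.
have LSae := sketch_le_LS_max n0 bndS.
move: (mu_D_le_second_moment iSS n0) gle LS0 LSae muLS muD0.
move: (mu_D P S) (LS_max P S) => mu L second gle LS0 LSae muLS mu0.
have -> : inf (range (ftilde P S f s)) = ftilde P S f s xstar.
  apply/le_anti/andP; split.
    by apply: ge_inf; [exists (ftilde P S f s xstar) => _ [x _ <-]|exists xstar].
  by apply: lb_le_inf; [exists (ftilde P S f s xstar), xstar|move=> _ [x _ <-]].
have gL1 : gamma * (Lf * L) <= 1.
  by move: gle; rewrite ler_pdivlMr // mulr_gt0.
have mmL : mu * muf <= Lf * L.
  by rewrite mulrC; apply: ler_pM => //; exact: ltW.
pose a := 1 - gamma * mu * muf.
have a0 : 0 <= a.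
  by rewrite subr_ge0 -mulrA (le_trans _ gL1) // ler_wpM2l // ltW.
have a1 : a <= 1 by rewrite gerBl !mulr_ge0 // ltW.
set Delta := ftilde P S f s xstar - inf (range f).
have Delta0 : 0 <= Delta.
  by rewrite subr_ge0; exact: (inf_range_le_ftilde mS iS iSS smoothf).
(* [c] is the fixed point of [r |-> a r + 2 gamma^2 Lf L Delta], so the per-step error can be
   written [(1 - a) * c]. *)
set c := _ / _ * Delta.
have c0 : 0 <= c.
  by rewrite /c mulr_ge0 // divr_ge0 // !mulr_ge0 // ltW.
have ac : (1 - a) * c = 2 * gamma ^+ 2 * (Lf * L) * Delta.
  by rewrite /c /a; field; rewrite !gt_eqF.
apply: (@le_trans _ _ (a ^+ t * sqnorm (x0 - xstar) + (1 - a ^+ t) * c)%:E);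
  last first.
  by rewrite lee_fin lerD2l ler_piMl // gerBl exprn_ge0.
apply: (Eiter_foldl_drift (step := fun x w => dsgd_step gf s gamma x (S w))
  (V := fun x => sqnorm (x - xstar))) => // [x|x]; first exact: sqnorm_ge0.
pose k := 2 * gamma ^+ 2 * (Lf * L).
(* The bound of [dsgd_step_sqdist] regrouped as a linear combination of integrable terms. *)
pose B w := (sqnorm (x - xstar) - k * inf (range f))
  + ((k - 2 * gamma) * f_S f s (S w) x + (2 * gamma * f_S f s (S w) xstar
  + (- (gamma * muf)) * sqnorm (S w *m (x - xstar)))).
have i1 := finite_measure_integrable_cst P
  (sqnorm (x - xstar) - k * inf (range f)) measurableT.
have i2 y := integrable_f_S mS iS iSS smoothf s y.
have i3 := integrable_sqnorm_sketch iSS (x - xstar).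
have j2 := integrable_EFinZl (k - 2 * gamma) (i2 x).
have j2' := integrable_EFinZl (2 * gamma) (i2 xstar).
have j3 := integrable_EFinZl (- (gamma * muf)) i3.
have j4 := integrable_EFinD j2' j3.
have j5 := integrable_EFinD j2 j4.
exists B; split.
- exact: integrable_EFinD.
- apply: filterS LSae => w Lw.
  apply: le_trans (dsgd_step_sqdist smoothf scf s x xstar L0 g0 (ltW LS0) Lw) _.
  by rewrite le_eqVlt; apply/orP; left; apply/eqP; rewrite /B /k; ring.
rewrite (RintegralD measurableT i1 j5) (RintegralD measurableT j2 j4).
rewrite (RintegralD measurableT j2' j3) !RintegralZl //.
rewrite Rintegral_cst //= [X in fine X](@probability_setT _ _ _ P) mulr1.
rewrite ac -/(ftilde P S f s x) -/(ftilde P S f s xstar).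
have gm0 : 0 <= gamma * muf by rewrite mulr_ge0 // ltW.
have h1 := ler_wpM2l gm0 (second (x - xstar)).
(* Splitting [ftilde x - inf f] as [(ftilde x - ftilde xstar) + Delta] leaves minus this product,
   which the step-size condition and minimality of [xstar] allow to be dropped. *)
have h2 : 0 <= 2 * gamma * (1 - gamma * (Lf * L))
    * (ftilde P S f s x - ftilde P S f s xstar).
  by rewrite !mulr_ge0 ?subr_ge0 // ltW.
rewrite /a /k /Delta /ftilde /Rintegral in h1 h2 *.
lra.
Qed.
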